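(* Let $U,V,W$ be finite-dimensional real vector spaces and let $r<r_g$, where $r_g$ is the complex generic rank of $U_{\mathbb{C}}\otimes V_{\mathbb{C}}\otimes W_{\mathbb{C}}$. If $U_{\mathbb{C}}\otimes V_{\mathbb{C}}\otimes W_{\mathbb{C}}$ is $r$-identifiable, then $U\otimes V\otimes W$ is $r$-identifiable.
   Context: $U_{\mathbb{C}}=U\otimes_{\mathbb{R}}\mathbb{C}$, and similarly for $V,W$; $r$ is a positive integer. Over $\mathbb{K}=\mathbb{R}$ or $\mathbb{C}$, the rank of a tensor is the minimum number of rank-one tensors $u\otimes v\otimes w$ (vectors over $\mathbb{K}$) summing to it. The complex generic rank $r_g$ is the integer $s$ such that the set of tensors of rank $s$ in $U_{\mathbb{C}}\otimes V_{\mathbb{C}}\otimes W_{\mathbb{C}}$ contains a nonempty Zariski open subset. A rank-$r$ decomposition of $T$ (over $\mathbb{K}$) is an expression $T=\sum_{i=1}^r T_i$ as a sum of $r=\operatorname{rank}(T)$ rank-one tensors over $\mathbb{K}$; it is unique if the unordered set $\{T_1,\dots,T_r\}$ is unique. A tensor space over $\mathbb{K}$ is $r$-identifiable if a general tensor of rank $r$ (over $\mathbb{K}$) in it has a unique rank-$r$ decomposition over $\mathbb{K}$. Here ''a general point of a semialgebraic set $S$ has property $\mathscr{P}$'' means that the points of $S$ not having $\mathscr{P}$ are contained in a semialgebraic subset $C\subseteq S$ with $\dim C<\dim S$ (in the complex case, the exceptional points are contained in a subvariety of smaller dimension than that of the Zariski closure of the set of rank-$r$ tensors). *)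

(* Defs.v *)
From HB Require Import structures.
From mathcomp Require Import all_boot all_order all_algebra ssrAC.
From mathcomp Require Import boolp classical_sets reals.
From mathcomp Require Import complex mxtens mpoly.

Set Implicit Arguments.
Unset Strict Implicit.
Unset Printing Implicit Defensive.

Import Order.TTheory GRing.Theory Num.Theory.
Local Open Scope classical_set_scope.
Local Open Scope ring_scope.

(* The pair (u, v) stands for u (x) 1 + v (x) i. *)
Section Complexification.
Variables (R : rcfType) (U : vectType R).

Definition complexification : Type := (U * U)%type.

HB.instance Definition _ := GRing.Zmodule.copy complexification (U * U)%type.

Definition cscale (a : R[i]) (u : complexification) : complexification :=
  (complex.Re a *: u.1 - complex.Im a *: u.2,
   complex.Re a *: u.2 + complex.Im a *: u.1).

Fact cscaleA a b u : cscale a (cscale b u) = cscale (a * b) u.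
Proof.
case: a b u => [a a'] [b b'] [u v]; rewrite /cscale /=; congr (_, _);
  rewrite !scalerDr !scalerDl ?scalerN ?scaleNr !scalerA.
- by rewrite !opprD [RHS](AC (2*2) ((1*3)*(4*2))).
- by rewrite [RHS](AC (2*2) ((1*3)*(4*2))).
Qed.

Fact cscale1 u : cscale 1 u = u.
Proof. by case: u => u v; rewrite /cscale /= !scale1r !scale0r subr0 addr0. Qed.

Fact cscaleDr a : {morph cscale a : u v / u + v}.
Proof.
case: a => [a a'] [u v] [u' v']; rewrite /cscale /=; congr (_, _);
  by rewrite /= !scalerDr ?opprD addrACA.
Qed.

Fact cscaleDl u : {morph cscale^~ u : a b / a + b}.
Proof.
case: u => [u v] [a a'] [b b']; rewrite /cscale /=; congr (_, _);
  by rewrite /= !scalerDl ?opprD addrACA.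
Qed.

HB.instance Definition _ := GRing.Zmodule_isLmodule.Build R[i] complexification
  cscaleA cscale1 cscaleDr cscaleDl.

Fact complexification_vect : Vector.axiom (\dim {:U}) complexification.
Proof.
pose b := vbasis {:U}.
pose f (u : complexification) : 'rV[R[i]]_(\dim {:U}) :=
  \row_i (coord b i u.1 +i* coord b i u.2)%C.
pose g (x : 'rV[R[i]]_(\dim {:U})) : complexification :=
  (\sum_i complex.Re (x 0 i) *: b`_i, \sum_i complex.Im (x 0 i) *: b`_i).
exists f.
  move=> [a a'] [u v] [u' v']; apply/rowP => i; rewrite !mxE /=.
  apply/eqP; rewrite eq_complex /=.
  by rewrite !linearD /= linearN /= !linearZ /= !eqxx.
exists g => [[u v]|x].
  by congr (_, _); rewrite [RHS](coord_vbasis (memvf _));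
     apply: eq_bigr => i _; rewrite mxE.
apply/rowP => i; rewrite mxE /= !coord_sum_free ?(basis_free (vbasisP _)) //.
by case: (x 0 i).
Qed.

HB.instance Definition _ :=
  Lmodule_hasFinDim.Build R[i] complexification complexification_vect.

End Complexification.

Section AffineGeometry.
Variables (K : fieldType) (N : nat).
Implicit Types (S T Z : set 'rV[K]_N) (f : {mpoly K[N]}).

Definition peval f (x : 'rV[K]_N) : K := f.@[x 0].

Definition vanishing S : set {mpoly K[N]} :=
  [set f | forall x, S x -> peval f x = 0].

Definition zero_locus (I : set {mpoly K[N]}) : set 'rV[K]_N :=
  [set x | forall f, I f -> peval f x = 0].

(* Possibly reducible; "subvariety" is understood in this sense. *)
Definition zariski_closed Z := exists I, Z = zero_locus I.

Definition zariski_open Z := zariski_closed (~` Z).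

Definition zariski_closure S := zero_locus (vanishing S).

Definition prime_ideal (P : {pred {mpoly K[N]}}) :=
  idealr_closed P /\ prime_idealr_closed P.

(* A chain P 0 < ... < P d of prime ideals of K[X_1, ..., X_N] containing the *)
(* ideal of S, i.e. a chain of d + 1 prime ideals of K[X_1, ..., X_N] / I(S). *)
Definition prime_chain S (d : nat) :=
  exists P : nat -> {pred {mpoly K[N]}},
    [/\ forall i, (i <= d)%N -> prime_ideal (P i),
        forall f, vanishing S f -> f \in P 0%N
      & forall i, (i < d)%N ->
          {subset P i <= P i.+1} /\ exists2 f, f \in P i.+1 & f \notin P i].

(* dim S is the Krull dimension of K[X_1, ..., X_N] / I(S), the supremum (-oo *)
(* for S empty) of the d such that prime_chain S d; these d are closed        *)
(* downwards, so that dim S < dim T reads as follows.                         *)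
Definition dim_lt S T := exists d, prime_chain T d /\ ~ prime_chain S d.

Definition zariski_general S (Q : 'rV[K]_N -> Prop) :=
  exists Z, [/\ zariski_closed Z,
                forall x, S x -> ~ Q x -> Z x
              & dim_lt Z (zariski_closure S)].

End AffineGeometry.

Section SemialgebraicGeometry.
Variables (R : realFieldType) (N : nat).

(* A finite union of sets {f_1 = ... = f_k = 0, g_1 > 0, ..., g_l > 0}. *)
Definition semialgebraic (S : set 'rV[R]_N) :=
  exists s : seq (seq {mpoly R[N]} * seq {mpoly R[N]}),
    S = [set x | has (fun fg => all (fun f => peval f x == 0) fg.1
                                && all (fun g => 0 < peval g x) fg.2) s].

Definition semialgebraic_general (S : set 'rV[R]_N) (Q : 'rV[R]_N -> Prop) :=
  exists C, [/\ semialgebraic C, C `<=` S,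
                forall x, S x -> ~ Q x -> C x
              & dim_lt C S].

End SemialgebraicGeometry.

Section TensorRank.
Variables (K : fieldType) (U V W : vectType K).

Definition coords (E : vectType K) (x : E) : 'rV[K]_(\dim {:E}) :=
  \row_i coord (vbasis {:E}) i x.

(* U (x) V (x) W, in the coordinates given by the basis e_i (x) f_j (x) g_k   *)
(* built from the library's bases of U, V and W; *t is the Kronecker product. *)
Definition tensor : Type := 'rV[K]_(\dim {:U} * \dim {:V} * \dim {:W}).

Definition pure_tensor (u : U) (v : V) (w : W) : tensor :=
  coords u *t coords v *t coords w.

Definition rank_one (t : tensor) :=
  t != 0 /\ exists u v w, t = pure_tensor u v w.

Definition decomposition (t : tensor) (s : seq tensor) :=
  (forall x, x \in s -> rank_one x) /\ t = \sum_(x <- s) x.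

Definition has_rank (r : nat) (t : tensor) :=
  (exists2 s, decomposition t s & size s = r) /\
  forall s, decomposition t s -> (r <= size s)%N.

Definition unique_decomposition (r : nat) (t : tensor) :=
  exists s, [/\ decomposition t s, size s = r
              & forall s', decomposition t s' -> size s' = r -> s' =i s].

Definition generic_rank (s : nat) :=
  exists O : set tensor, [/\ zariski_open O, O !=set0 & O `<=` has_rank s].

End TensorRank.

Arguments has_rank {K} U V W r t.
Arguments unique_decomposition {K} U V W r t.
Arguments generic_rank {K} U V W s.

Definition real_identifiable (R : realFieldType) (U V W : vectType R) (r : nat) :=
  semialgebraic_general (has_rank U V W r) (unique_decomposition U V W r).

Definition complex_identifiable (R : rcfType) (U V W : vectType R[i]) (r : nat) :=
  zariski_general (has_rank U V W r) (unique_decomposition U V W r).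

(* Main.v *)
Require Import Defs.
From HB Require Import structures.
From mathcomp Require Import all_boot all_order all_algebra.
From mathcomp Require Import reals complex.
From mathcomp Require Import boolp classical_sets.
From mathcomp Require Import mxtens ordered_qelim mpoly ring zify.
From mathcomp Require qe_rcf.

Set Implicit Arguments.
Unset Strict Implicit.
Unset Printing Implicit Defensive.

Import Order.TTheory GRing.Theory Num.Theory.
Local Open Scope ring_scope.

(* Let X_s be the set of sums of s pure tensors. It is the image of a         *)
(* polynomial map with rational coefficients, so a real polynomial vanishing  *)
(* on its real version vanishes on the complex one, and its ideal is prime.   *)
(* If that ideal did not change from r - 1 to r it would be constant from     *)
(* r - 1 on, against r < r_g; so the tensors of complex rank < r have smaller *)
(* dimension than X_r, and real tensors of real rank r are Zariski dense in   *)
(* the real X_r. A real decomposition of a real tensor of complex rank r is   *)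
(* also a complex one, so the real tensors of rank r with several             *)
(* decompositions are real points of the complex exceptional locus or of      *)
(* X_(r-1). Chains of primes pass from C[X] to R[X] by contraction and back   *)
(* by lying over and going up, which compares the dimensions.                 *)

(** * Krull dimension of polynomial rings *)

(** Dimensions are compared through chains of primes. Let D be the dimension of the complex X_r; it
    is finite because a chain is no longer than the number of variables ([prime_chain_bound],
    [prime_chain_max]). The real tensors of rank r reach dimension D: a real polynomial vanishing on
    them vanishes on the real X_r ([vanishing_rank_eq]), hence on the complex one
    ([vanishing_rank_le_toC]), and chains of C[X] contract strictly to R[X]
    ([prime_chain_contract]). The real tensors with several decompositions do not reach D
    ([no_long_chain]). A chain of length D over their ideal extends to C[X], and its smallest prime
    contains the ideal of the complex exceptional locus or that of X_(r-1). The first is excluded by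
    the dimension of that locus. In the second case the ideal of X_r, strictly smaller by
    [rank_le_not_dense], can be put in front, giving a chain of length D + 1 for X_r. Finally, the
    set of these tensors is itself semialgebraic, by quantifier elimination
    ([definable_semialgebraic]). *)

Section PrimeIdeals.
Variables (K : fieldType) (N : nat).
Implicit Types (P : {pred {mpoly K[N]}}) (x y : {mpoly K[N]}).

Lemma prime_ideal0 P : prime_ideal P -> 0 \in P.
Proof. by case=> [[]]. Qed.

Lemma prime_ideal1 P : prime_ideal P -> 1 \notin P.
Proof. by case=> [[]]. Qed.

Lemma prime_idealMl P x y : prime_ideal P -> y \in P -> x * y \in P.
Proof. by case=> [[P0 _ PD]] _ Py; rewrite -[x * y]addr0 PD. Qed.

Lemma prime_idealD P x y : prime_ideal P -> x \in P -> y \in P -> x + y \in P.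
Proof. by case=> [[P0 _ PD]] _ Px Py; rewrite -[x]mul1r PD. Qed.

Lemma prime_idealN P x : prime_ideal P -> x \in P -> - x \in P.
Proof. by move=> hP Px; rewrite -mulN1r prime_idealMl. Qed.

Lemma prime_idealB P x y : prime_ideal P -> x \in P -> y \in P -> x - y \in P.
Proof. by move=> hP Px Py; rewrite prime_idealD ?prime_idealN. Qed.

Lemma prime_idealM P x y :
  prime_ideal P -> (x * y \in P) = (x \in P) || (y \in P).
Proof.
move=> hP; apply/idP/orP => [/hP.2/orP//|[] ?]; last exact: prime_idealMl.
by rewrite mulrC prime_idealMl.
Qed.

Lemma prime_idealX2 P x : prime_ideal P -> (x ^+ 2 \in P) = (x \in P).
Proof. by move=> hP; rewrite expr2 prime_idealM // orbb. Qed.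

Lemma prime_idealDr P x y :
  prime_ideal P -> y \in P -> (x + y \in P) = (x \in P).
Proof.
move=> hP Py; apply/idP/idP => [Pxy|Px]; last exact: prime_idealD.
by rewrite -[x](addrK y) prime_idealB.
Qed.

Lemma prime_idealC P (c : K) : prime_ideal P -> (c%:MP \in P) = (c == 0).
Proof.
move=> hP; apply/idP/eqP => [Pc|->]; last by rewrite mpolyC0 prime_ideal0.
apply/eqP/negP => /negP c0; have := prime_ideal1 hP.
by rewrite -[1]mpolyC1 -(mulVf c0) mpolyCM prime_idealMl.
Qed.

(** * Algebraic dependence and the bound on the length of chains *)

Fixpoint exponents (m n : nat) : seq (seq nat) :=
  if n is n'.+1 then [seq k :: e | k <- iota 0 m, e <- exponents m n']
  else [:: [::]].

Lemma size_exponents m n : size (exponents m n) = (m ^ n)%N.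
Proof. by elim: n => //= n IH; rewrite size_allpairs size_iota IH expnS. Qed.

Lemma exponents_uniq m n : uniq (exponents m n).
Proof.
elim: n => //= n IH; apply: allpairs_uniq; rewrite ?iota_uniq //.
by move=> [k e] [k' e'] _ _ /= [-> ->].
Qed.

Lemma mem_exponents m n e :
  (e \in exponents m n) = (size e == n) && all (ltn^~ m) e.
Proof.
elim: n e => [|n IH] [|k e] //=.
  by apply/negbTE/negP => /allpairsP[[k e] [_ _]].
rewrite eqSS andbCA -IH; apply/allpairsP/andP.
  by move=> [[k' e'] /= [+ + [-> ->]]]; rewrite mem_iota.
by move=> [km he]; exists (k, e); rewrite mem_iota.
Qed.

Fixpoint monomial (e : seq nat) (xs : seq {mpoly K[N]}) : {mpoly K[N]} :=
  match e, xs with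
  | k :: e', x :: xs' => x ^+ k * monomial e' xs'
  | _, _ => 1
  end.

(** Exponents are bounded separately in each variable, so that the first variable can be split off
    as in [relation_cons]. *)
Definition relation m (q : seq nat -> K) xs :=
  \sum_(e <- exponents m (size xs)) q e *: monomial e xs.

Lemma relation_cons m q x xs : relation m q (x :: xs) =
  \sum_(k < m) x ^+ k * relation m (fun e => q (val k :: e)) xs.
Proof.
rewrite /relation /= big_allpairs_dep /= -(big_mkord xpredT (fun k =>
  x ^+ k * \sum_(e <- _) q (k :: e) *: monomial e xs)) /index_iota subn0.
apply: eq_bigr => k _; rewrite big_distrr /=; apply: eq_bigr => e _.
by rewrite scalerAr.
Qed.

Lemma relation_eq0 m q xs :
  (forall e, e \in exponents m (size xs) -> q e = 0) -> relation m q xs = 0.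
Proof.
move=> q0; rewrite /relation big_seq big1 // => e /q0 ->.
by rewrite scale0r.
Qed.

(* The lowest coefficient lies in P' and so is zero; then x, which is not in  *)
(* P, can be cancelled.                                                       *)
Lemma peel_powers P P' x m (A : nat -> {mpoly K[N]}) :
  prime_ideal P -> prime_ideal P' -> {subset P <= P'} -> x \in P' ->
  x \notin P ->
  (forall j, A j \in P' -> A j = 0) -> \sum_(j < m) x ^+ j * A j \in P ->
  forall j, (j < m)%N -> A j \in P'.
Proof.
move=> hP hP' PP' Px Pnx; elim: m A => // m IH A A0.
rewrite big_ord_recl expr0 mul1r.
under eq_bigr do rewrite /= /bump /= add1n exprS -mulrA.
rewrite -big_distrr /= => hS.
have PA0 : A 0%N \in P'.
  have := PP' _ hS; rewrite prime_idealDr // mulrC.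
  exact: prime_idealMl.
move: hS; rewrite (A0 _ PA0) add0r prime_idealM // (negbTE Pnx) /= => hS.
by case=> // j jm; apply: (IH (fun j => A j.+1)) => // i; apply: A0.
Qed.

(* Such xs are algebraically independent; N + 1 polynomials never are, which  *)
(* bounds the length of the chain.                                            *)
Lemma chain_independent m (P : nat -> {pred {mpoly K[N]}}) xs q :
  (forall i, (i <= size xs)%N -> prime_ideal (P i)) ->
  (forall i, (i < size xs)%N ->
     [/\ {subset P i <= P i.+1}, xs`_i \in P i.+1 & xs`_i \notin P i]) ->
  relation m q xs \in P 0%N ->
  forall e, e \in exponents m (size xs) -> q e = 0.
Proof.
elim: xs P q => [|x xs IH] P q hP hxs.
  rewrite /relation /= big_seq1 /= -mul_mpolyC mulr1.
  rewrite (prime_idealC _ (hP 0%N isT)).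
  by move=> /eqP q0 e; rewrite inE => /eqP ->.
rewrite relation_cons => Pq.
have IH' q' : relation m q' xs \in P 1%N ->
    forall e, e \in exponents m (size xs) -> q' e = 0.
  apply: (IH (P \o succn)) => i hi /=; first exact: hP.
  exact: (hxs i.+1).
have [PP Px Pnx] := hxs 0%N isT.
pose A k := relation m (fun e => q (k :: e)) xs.
have hA := @peel_powers _ _ _ m A (hP 0%N isT) (hP 1%N isT) PP Px Pnx _ Pq.
move=> _ /allpairsP[[k e] /= [+ he ->]]; rewrite mem_iota /= add0n => km.
apply: (IH' (fun e => q (k :: e))) => //.
by apply: (hA _ k km) => j Pj; apply: relation_eq0; apply: IH'.
Qed.

Lemma msize_monomial D m e xs : all (ltn^~ m) e ->
  all (fun x => msize x <= D.+1)%N xs ->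
  (msize (monomial e xs) <= (size xs * (m * D)).+1)%N.
Proof.
have msM x y a b : (msize x <= a.+1 -> msize y <= b.+1 ->
    msize (x * y) <= (a + b).+1)%N.
  move=> xa yb; have [->|x0] := eqVneq x 0; first by rewrite mul0r msize0.
  have [->|y0] := eqVneq y 0; first by rewrite mulr0 msize0.
  by rewrite msizeM //; move: (msize x) (msize y) xa yb => i j; lia.
elim: xs e => [|x xs IH] [|k e] //= ; rewrite ?msize1 //.
move=> /andP[km he] /andP[xD hxs]; rewrite mulSn.
apply: (msM) (IH _ he hxs).
suff : (msize (x ^+ k) <= (k * D).+1)%N.
  by move=> /leq_trans; apply; rewrite ltnS leq_mul2r ltnW ?orbT.
elim: k {km} => [|k IHk]; first by rewrite expr0 msize1.
by rewrite exprS mulSn msM.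
Qed.

Lemma card_bmultinom d : (#|{: 'X_{1..N < d.+1}}| <= d.+1 ^ N)%N.
Proof.
have le_d (e : 'X_{1..N < d.+1}) i : (e i < d.+1)%N.
  apply: leq_ltn_trans (bmdeg e); rewrite mdegE.
  by rewrite (bigD1 i) //= leq_addr.
pose f (e : 'X_{1..N < d.+1}) := [ffun i => Ordinal (le_d e i)].
have fI : injective f.
  move=> e e' /ffunP eq_f; apply/val_inj/mnmP => i.
  by have /(congr1 val) := eq_f i; rewrite !ffunE.
apply: leq_trans (leq_card _ fI) _.
by rewrite card_ffun !card_ord.
Qed.

Lemma kermx_witness p n (A : 'M[K]_(p, n)) :
  (n < p)%N -> exists2 v : 'rV_p, v != 0 & v *m A = 0.
Proof.
move=> ltnp; have : kermx A != 0.
  rewrite -mxrank_eq0 mxrank_ker subn_eq0 -ltnNge.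
  exact: leq_ltn_trans (rank_leq_col A) ltnp.
by move=> /rowV0Pn[v /sub_kermxP vA v0]; exists v.
Qed.

(** A count of dimensions: the m ^ N.+1 monomials in [xs] with exponents below m have degree at most
    d, which is linear in m, so they lie in a space of dimension at most d.+1 ^ N. For large m they
    are linearly dependent. *)
Lemma algebraic_dependence xs : size xs = N.+1 ->
  exists m q, relation m q xs = 0 /\
    exists2 e, e \in exponents m (size xs) & q e != 0.
Proof.
move=> sxs; pose D := \max_(x <- xs) msize x.
have xsD : all (fun x => msize x <= D.+1)%N xs.
  apply/allP => x xin; apply: leqW.
  by rewrite /D (big_rem x) //= leq_maxl.
(* [C] is chosen so that d.+1 <= m * C, and [m] exceeds C ^ N, whence (m * C) ^ N < m ^ N.+1. *)
pose C := (N.+1 * D).+1; pose m := (C ^ N).+1.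
pose d := (size xs * (m * D))%N; pose E := exponents m (size xs).
have dE : (#|{: 'X_{1..N < d.+1}}| < size E)%N.
  apply: leq_ltn_trans (card_bmultinom d) _; rewrite size_exponents sxs.
  apply: (@leq_ltn_trans ((m * C) ^ N)).
    have leX i j : (i <= j -> i ^ N <= j ^ N)%N.
      by case: (N) => // n ij; rewrite leq_exp2r.
    by apply: leX; rewrite /d sxs /C; nia.
  by rewrite expnMn expnS mulnC ltn_pmul2r ?expn_gt0.
pose A := \matrix_(i < size E, j < #|{: 'X_{1..N < d.+1}}|)
  (monomial (nth [::] E i) xs)@_(enum_val j).
have [v v0 vA] := kermx_witness A dE.
pose q e := \sum_(i < size E | nth [::] E i == e) v 0 i.
have qE (i : 'I_(size E)) : q (nth [::] E i) = v 0 i.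
  rewrite /q (big_pred1 i) // => j; rewrite /= nth_uniq ?exponents_uniq //.
exists m, q; split.
  have -> : relation m q xs =
      \sum_(i < size E) v 0 i *: monomial (nth [::] E i) xs.
    rewrite /relation (big_nth [::]) big_mkord.
    by apply: eq_bigr => i _; rewrite qE.
  apply/mpolyP => e; rewrite mcoeff0 raddf_sum /=.
  under eq_bigr do rewrite mcoeffZ.
  have [ed|de] := ltnP (mdeg e) d.+1.
    have := congr1 (fun w : 'rV_ _ => w 0 (enum_rank (BMultinom ed))) vA.
    rewrite !mxE => /(etrans _); apply; apply: eq_bigr => i _.
    by rewrite mxE enum_rankK.
  apply: big1 => i _; rewrite memN_msupp_eq0 ?mulr0 //.
  apply: msize_mdeg_ge; apply: leq_trans de; apply: msize_monomial => //.
  have : nth [::] E i \in E by apply: mem_nth.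
  by rewrite mem_exponents => /andP[].
have [i vi] : exists i, v 0 i != 0 by apply/rV0Pn.
by exists (nth [::] E i); rewrite ?qE ?mem_nth.
Qed.

Lemma prime_chain_bound (S : set 'rV[K]_N) d : prime_chain S d -> (d <= N)%N.
Proof.
move=> [P [hP _ hchain]]; rewrite leqNgt; apply/negP => ltNd.
have /choice[x hx] i : exists x, (i < d)%N -> x \in P i.+1 /\ x \notin P i.
  have [id|] := ltnP i d; last by exists 0.
  by have [_ [f f1 f0]] := hchain i id; exists f.
pose xs := mkseq x N.+1.
have sxs : size xs = N.+1 by rewrite size_mkseq.
have [m [q [rel0 [e he]]]] := algebraic_dependence sxs.
rewrite (@chain_independent m P xs q) ?eqxx // ?sxs.
- by move=> i iN; apply/hP/(leq_trans iN).
- move=> i iN; have id : (i < d)%N by apply: leq_trans ltNd.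
  by rewrite nth_mkseq //; have [? _] := hchain i id; have [] := hx i id.
- by rewrite rel0; apply/prime_ideal0/hP.
Qed.

Lemma prime_chain_le (S : set 'rV[K]_N) d d' :
  (d' <= d)%N -> prime_chain S d -> prime_chain S d'.
Proof.
move=> led [P [hP PS hchain]]; exists P; split => // i hi.
  by apply: hP; apply: leq_trans led.
by apply: hchain; apply: leq_trans led.
Qed.

End PrimeIdeals.

(** * Primes of R[X] and of C[X] *)

HB.lock Definition toC (R : rcfType) (N : nat) (p : {mpoly R[N]}) :
  {mpoly R[i][N]} := map_mpoly (real_complex R) p.

HB.lock Definition re_mpoly (R : rcfType) (N : nat) (f : {mpoly R[i][N]}) :
  {mpoly R[N]} := \sum_(m <- msupp f) complex.Re f@_m *: 'X_[m].

HB.lock Definition im_mpoly (R : rcfType) (N : nat) (f : {mpoly R[i][N]}) :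
  {mpoly R[N]} := \sum_(m <- msupp f) complex.Im f@_m *: 'X_[m].

Section RealAndImaginaryParts.
Variables (R : rcfType) (N : nat).
Implicit Types (f g : {mpoly R[i][N]}) (p q : {mpoly R[N]}).
Implicit Types (P : {pred {mpoly R[N]}}) (Q : {pred {mpoly R[i][N]}}).

Definition iC : {mpoly R[i][N]} := ('i%C)%:MP.

Lemma toCE p : toC p = map_mpoly (real_complex R) p.
Proof. by rewrite toC.unlock. Qed.

Fact toC_additive : {morph @toC R N : p q / p - q}.
Proof. by move=> p q; rewrite !toCE raddfB. Qed.

Fact toC_multiplicative : multiplicative (@toC R N).
Proof. by split=> [p q|]; rewrite !toCE ?rmorphM ?rmorph1. Qed.

HB.instance Definition _ := GRing.isAdditive.Build _ _ (@toC R N) toC_additive.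
HB.instance Definition _ :=
  GRing.isMultiplicative.Build _ _ (@toC R N) toC_multiplicative.

Lemma mcoeff_toC m p : (toC p)@_m = (p@_m)%:C%C.
Proof. by rewrite toCE mcoeff_map_mpoly. Qed.

Lemma iC2 : iC * iC = -1.
Proof. by rewrite -mpolyCM -expr2 sqr_i mpolyCN mpolyC1. Qed.

Lemma mpoly_complexE f : f = toC (re_mpoly f) + iC * toC (im_mpoly f).
Proof.
rewrite [LHS]mpolyE re_mpoly.unlock im_mpoly.unlock !raddf_sum /= big_distrr.
rewrite -big_split /=.
apply: eq_bigr => m _; rewrite !toCE !map_mpolyZ map_mpolyX mul_mpolyC scalerA.
by rewrite -scalerDl -complexE.
Qed.

(** C[X] is the direct sum of R[X] and i R[X]; real and imaginary parts of sums and products are all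
    computed through this uniqueness. *)
Lemma re_im_mpoly_unique f p q :
  f = toC p + iC * toC q -> re_mpoly f = p /\ im_mpoly f = q.
Proof.
move=> fE; have := mpoly_complexE f; rewrite {1}fE => /mpolyP eq_pq.
suff eqm m : p@_m = (re_mpoly f)@_m /\ q@_m = (im_mpoly f)@_m.
  by split; apply/mpolyP => m; case: (eqm m).
have := eq_pq m; rewrite !mcoeffD !mcoeffCM !mcoeff_toC.
set a := q@_m; set b := (im_mpoly f)@_m; set c := p@_m; set d := _@_m.
by case; rewrite !(mul0r, mul1r, subr0, addr0, add0r).
Qed.

End RealAndImaginaryParts.

Section ComplexPrimes.
Variables (R : rcfType) (N : nat).
Implicit Types (f g : {mpoly R[i][N]}) (p q : {mpoly R[N]}).
Implicit Types (P : {pred {mpoly R[N]}}) (Q : {pred {mpoly R[i][N]}}).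

Local Notation iC := (iC R N).

Lemma re_im_mpolyD f g : re_mpoly (f + g) = re_mpoly f + re_mpoly g /\
  im_mpoly (f + g) = im_mpoly f + im_mpoly g.
Proof.
apply: re_im_mpoly_unique; rewrite [in LHS](mpoly_complexE f).
by rewrite [in LHS](mpoly_complexE g) !rmorphD mulrDr addrACA.
Qed.

Lemma re_im_mpolyM f g :
  re_mpoly (f * g) = re_mpoly f * re_mpoly g - im_mpoly f * im_mpoly g /\
  im_mpoly (f * g) = re_mpoly f * im_mpoly g + im_mpoly f * re_mpoly g.
Proof.
apply: re_im_mpoly_unique; rewrite [in LHS](mpoly_complexE f).
rewrite [in LHS](mpoly_complexE g) rmorphB rmorphD !rmorphM.
set a := toC _; set b := toC (im_mpoly f); set c := toC (re_mpoly g).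
set d := toC (im_mpoly g).
transitivity (a * c + (iC * iC) * (b * d) + iC * (a * d + b * c)); first ring.
by rewrite iC2; ring.
Qed.

Lemma re_im_toC p : re_mpoly (toC p) = p /\ im_mpoly (toC p) = 0.
Proof. by apply: re_im_mpoly_unique; rewrite rmorph0 mulr0 addr0. Qed.

Definition conj_mpoly f := toC (re_mpoly f) - iC * toC (im_mpoly f).

Definition norm_mpoly f := re_mpoly f ^+ 2 + im_mpoly f ^+ 2.

Lemma conj_mpolyD f g : conj_mpoly (f + g) = conj_mpoly f + conj_mpoly g.
Proof.
rewrite /conj_mpoly; have [-> ->] := re_im_mpolyD f g.
by rewrite !rmorphD; ring.
Qed.

Lemma conj_mpolyM f g : conj_mpoly (f * g) = conj_mpoly f * conj_mpoly g.
Proof.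
rewrite /conj_mpoly; have [-> ->] := re_im_mpolyM f g.
rewrite rmorphB rmorphD !rmorphM.
set a := toC _; set b := toC _; set c := toC _; set d := toC _.
transitivity (a * c + (iC * iC) * (b * d) - iC * (a * d + b * c)); last ring.
by rewrite iC2; ring.
Qed.

Lemma conj_mpoly_toC p : conj_mpoly (toC p) = toC p.
Proof.
rewrite /conj_mpoly; have [-> ->] := re_im_toC p.
by rewrite rmorph0 mulr0 subr0.
Qed.

Lemma conj_mpoly1 : conj_mpoly 1 = 1.
Proof. by rewrite -(rmorph1 (@toC R N)) conj_mpoly_toC. Qed.

Lemma mulJ_mpoly f : f * conj_mpoly f = toC (norm_mpoly f).
Proof.
rewrite {1}[f]mpoly_complexE /conj_mpoly /norm_mpoly rmorphD !rmorphXn.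
set a := toC _; set b := toC _.
transitivity (a ^+ 2 - (iC * iC) * b ^+ 2); first ring.
by rewrite iC2; ring.
Qed.

Lemma norm_mpolyM f g : norm_mpoly (f * g) = norm_mpoly f * norm_mpoly g.
Proof.
rewrite /norm_mpoly; have [-> ->] := re_im_mpolyM f g.
by ring.
Qed.

Lemma addJ_mpoly f : f + conj_mpoly f = toC (re_mpoly f *+ 2).
Proof.
by rewrite {1}[f]mpoly_complexE /conj_mpoly rmorphMn addrACA subrr addr0.
Qed.

Lemma prime_ideal_toC Q : prime_ideal Q -> prime_ideal [pred p | toC p \in Q].
Proof.
move=> hQ; split; first split; rewrite ?inE ?rmorph0 ?rmorph1.
- exact: prime_ideal0.
- exact: prime_ideal1.
- move=> a p q; rewrite !inE => hp hq; rewrite rmorphD rmorphM.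
  by rewrite prime_idealD ?prime_idealMl.
- by move=> p q; rewrite !inE rmorphM prime_idealM.
Qed.

(* f * conj f and f + conj f are real, and conj f is determined by them. *)
Lemma prime_ideal_incomparable Q Q' :
  prime_ideal Q -> prime_ideal Q' -> {subset Q <= Q'} ->
  (forall p, toC p \in Q' -> toC p \in Q) -> {subset Q' <= Q}.
Proof.
move=> hQ hQ' QQ' hp f Q'f.
have : toC (norm_mpoly f) \in Q.
  by apply: hp; rewrite -mulJ_mpoly mulrC prime_idealMl.
rewrite -mulJ_mpoly prime_idealM // => /orP[//|Qfc].
have : toC (re_mpoly f *+ 2) \in Q.
  by apply: hp; rewrite -addJ_mpoly prime_idealD // QQ'.
by rewrite -addJ_mpoly prime_idealDr.
Qed.

(** Two cases, according to whether -1 is a square in the fraction field F of R[X]/P. If it is the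
    square of s/t, then Q is the kernel of the map from C[X] to F sending i to s/t. If not, F(i) is
    a field in which only 0 has norm 0, and Q consists of the f whose norm, or equivalently whose
    real and imaginary parts, lie in P. *)
Lemma lying_over P : prime_ideal P ->
  exists2 Q, prime_ideal Q & forall p, (toC p \in Q) = (p \in P).
Proof.
move=> hP.
have [[s [t [nPt Pst]]]|sq] :=
    pselect (exists s t, t \notin P /\ s ^+ 2 + t ^+ 2 \in P).
  (* [phi] is t times the map sending i to s/t, which clears denominators; it is multiplicative
     modulo P up to the factor t, which is not in P. *)
  pose phi f := t * re_mpoly f + s * im_mpoly f.
  have phiM f g : (phi f * phi g \in P) = (phi (f * g) \in P).
    have -> : phi f * phi g =
        t * phi (f * g) + (im_mpoly f * im_mpoly g) * (s ^+ 2 + t ^+ 2).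
      by rewrite /phi; have [-> ->] := re_im_mpolyM f g; ring.
    rewrite prime_idealDr //; last exact: prime_idealMl.
    by rewrite prime_idealM // (negbTE nPt).
  have phiD f g : phi (f + g) = phi f + phi g.
    by rewrite /phi; have [-> ->] := re_im_mpolyD f g; ring.
  have phi_toC p : (phi (toC p) \in P) = (p \in P).
    rewrite /phi; have [-> ->] := re_im_toC p.
    by rewrite mulr0 addr0 prime_idealM // (negbTE nPt).
  exists ([pred f | phi f \in P] : {pred {mpoly R[i][N]}}); last exact: phi_toC.
  split; first split; rewrite ?inE.
  - by rewrite -(rmorph0 (@toC R N)) phi_toC prime_ideal0.
  - by rewrite -(rmorph1 (@toC R N)) phi_toC prime_ideal1.
  - move=> a f g; rewrite !inE => Pf Pg; rewrite phiD prime_idealD //.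
    by rewrite -phiM prime_idealMl.
  - by move=> f g; rewrite !inE -phiM prime_idealM.
have normP f : (norm_mpoly f \in P) = (re_mpoly f \in P) && (im_mpoly f \in P).
  apply/idP/andP => [Pf|[Pr Pi]]; last by rewrite prime_idealD ?prime_idealX2.
  have Pi : im_mpoly f \in P.
    by apply/negPn/negP => nPi; apply: sq; exists (re_mpoly f), (im_mpoly f).
  split=> //; move: Pf; rewrite prime_idealDr ?prime_idealX2 //.
have norm_toC p : (norm_mpoly (toC p) \in P) = (p \in P).
  by rewrite normP; have [-> ->] := re_im_toC p; rewrite prime_ideal0 ?andbT.
exists ([pred f | norm_mpoly f \in P] : {pred {mpoly R[i][N]}});
  last exact: norm_toC.
split; first split; rewrite ?inE.
- by rewrite -(rmorph0 (@toC R N)) norm_toC prime_ideal0.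
- by rewrite -(rmorph1 (@toC R N)) norm_toC prime_ideal1.
- move=> a f g; rewrite !inE => Pf Pg.
  have : norm_mpoly (a * f) \in P by rewrite norm_mpolyM prime_idealMl.
  move: Pg; rewrite !normP; have [-> ->] := re_im_mpolyD (a * f) g.
  by move=> /andP[? ?] /andP[? ?]; rewrite !prime_idealD.
- by move=> f g; rewrite !inE norm_mpolyM prime_idealM.
Qed.

(* Any prime Q over P' works up to conjugation: Q0 lies in the union of Q and *)
(* its conjugate, because f * conj f is real, hence in one of the two.        *)
Lemma going_up P P' Q0 : prime_ideal P -> prime_ideal P' -> prime_ideal Q0 ->
  {subset P <= P'} -> (forall p, (toC p \in Q0) = (p \in P)) ->
  exists Q, [/\ prime_ideal Q, forall p, (toC p \in Q) = (p \in P')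
              & {subset Q0 <= Q}].
Proof.
move=> hP hP' hQ0 PP' Q0P; have [Q hQ QP'] := lying_over hP'.
have Q0QJ f : f \in Q0 -> (f \in Q) || (conj_mpoly f \in Q).
  move=> Q0f; rewrite -prime_idealM // mulJ_mpoly QP' PP' // -Q0P -mulJ_mpoly.
  by rewrite mulrC prime_idealMl.
have [sub|nsub] := pselect {subset Q0 <= Q}; first by exists Q.
have [f Q0f nQf] : exists2 f, f \in Q0 & f \notin Q.
  apply: contrapT => hn; apply: nsub => f Q0f; apply/negPn/negP => nQf.
  by apply: hn; exists f.
exists ([pred g | conj_mpoly g \in Q] : {pred {mpoly R[i][N]}}); split.
- split; first split; rewrite ?inE.
  + by rewrite -(rmorph0 (@toC R N)) conj_mpoly_toC QP' prime_ideal0.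
  + by rewrite conj_mpoly1 prime_ideal1.
  + move=> a g h; rewrite !inE => Qg Qh; rewrite conj_mpolyD conj_mpolyM.
    by rewrite prime_idealD ?prime_idealMl.
  + by move=> g h; rewrite !inE conj_mpolyM prime_idealM.
- by move=> p; rewrite inE conj_mpoly_toC.
move=> g Q0g; rewrite inE; have /orP[Qg|//] := Q0QJ g Q0g.
have Q0fg : f + g \in Q0 by rewrite prime_idealD.
have Qf : conj_mpoly f \in Q by have := Q0QJ f Q0f; rewrite (negbTE nQf).
have := Q0QJ _ Q0fg; rewrite prime_idealDr // (negbTE nQf) /=.
by rewrite conj_mpolyD addrC prime_idealDr.
Qed.

(** Contraction keeps inclusions strict: by [prime_ideal_incomparable], nested primes with the same
    real elements are equal. *)
Lemma prime_chain_contract (S : set 'rV[R[i]]_N) (S' : set 'rV[R]_N) d :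
  (forall p, vanishing S' p -> vanishing S (toC p)) ->
  prime_chain S d -> prime_chain S' d.
Proof.
move=> hS [Q [hQ QS hchain]].
exists (fun i => [pred p | toC p \in Q i] : {pred {mpoly R[N]}}).
split=> [i id|p S'p|i id].
- exact/prime_ideal_toC/hQ.
- by rewrite inE; apply/QS/hS.
have [sub [f Qf nQf]] := hchain i id.
split; first by move=> p; rewrite !inE; apply: sub.
apply: contrapT => hn; move/negP: nQf; apply.
apply: (prime_ideal_incomparable (hQ _ (ltnW id)) (hQ _ id) sub) Qf => p Qp.
apply/negPn/negP => nQp; apply: hn; exists p => //.
Qed.

(** [lying_over] starts the chain and [going_up] prolongs it. Strictness need not be tracked, since
    it can be read off the contractions. *)
Lemma prime_chain_lift (P : nat -> {pred {mpoly R[N]}}) d :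
  (forall i, (i <= d)%N -> prime_ideal (P i)) ->
  (forall i, (i < d)%N -> {subset P i <= P i.+1}) ->
  exists Q : nat -> {pred {mpoly R[i][N]}},
    [/\ forall i, (i <= d)%N -> prime_ideal (Q i),
        forall i p, (i <= d)%N -> (toC p \in Q i) = (p \in P i)
      & forall i, (i < d)%N -> {subset Q i <= Q i.+1}].
Proof.
elim: d => [|d IH] hP sub.
  have [Q hQ QP] := lying_over (hP 0%N isT).
  by exists (fun=> Q); split => // i; rewrite leqn0 => // p /eqP->.
have [||Q [hQ QP Qsub]] := IH.
- by move=> i id; apply/hP/leqW.
- by move=> i id; apply/sub/leqW.
have [Q' [hQ' QP' sub']] := going_up (hP d (leqnSn d)) (hP _ (leqnn _))
  (hQ _ (leqnn _)) (sub _ (leqnn _)) (fun p => QP d p (leqnn _)).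
exists (fun i => if (i <= d)%N then Q i else Q'); split.
- by move=> i _; case: ifP => // /hQ.
- move=> i p; rewrite leq_eqVlt => /orP[/eqP->|]; first by rewrite ltnn.
  by rewrite ltnS => id; rewrite id QP.
- move=> i; rewrite ltnS => id; rewrite id.
  case: ltnP => id'; first exact: Qsub.
  by have <- : d = i by apply/eqP; rewrite eqn_leq id id'.
Qed.

(** The first prime is constrained only through real polynomials; which complex locus it belongs to
    is decided in [no_long_chain]. *)
Lemma prime_chain_extend (S : set 'rV[R]_N) d : prime_chain S d ->
  exists Q : nat -> {pred {mpoly R[i][N]}},
    [/\ forall i, (i <= d)%N -> prime_ideal (Q i),
        forall p, vanishing S p -> toC p \in Q 0%N
      & forall i, (i < d)%N ->
          {subset Q i <= Q i.+1} /\ exists2 f, f \in Q i.+1 & f \notin Q i].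
Proof.
move=> [P [hP PS hchain]].
have [|Q [hQ QP Qsub]] := prime_chain_lift hP; first by move=> i /hchain[].
exists Q; split => // [p Sp|i id]; first by rewrite QP // PS.
split; first exact: Qsub.
have [_ [p Pp nPp]] := hchain i id.
by exists (toC p); rewrite QP // ltnW.
Qed.

End ComplexPrimes.

(** * Sums of pure tensors *)

Section SumsOfPureTensors.
Variables a b c : nat.

(** One function [y] lists the coordinates of the three vectors one after the other. The
    coefficients may lie in any commutative ring, so that parameters can be polynomials, as along a
    line in parameter space. *)
Definition tensor_entry (A : comNzRingType) (y : nat -> A)
    (l : 'I_(a * b * c)) :=
  let ij := mxtens_unindex (mxtens_unindex l).1 in
  y ij.1 * y (a + ij.2)%N * y (a + b + (mxtens_unindex l).2)%N.

Definition sum_entry (A : comNzRingType) s (y : nat -> nat -> A) l :=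
  \sum_(p < s) tensor_entry (y p) l.

Lemma rmorph_sum_entry (A B : comNzRingType) (h : {rmorphism A -> B}) s y l :
  h (sum_entry s y l) = sum_entry s (fun p i => h (y p i)) l.
Proof.
by rewrite rmorph_sum; apply: eq_bigr => p _; rewrite /tensor_entry !rmorphM.
Qed.

Section Field.
Variable K : fieldType.
Implicit Types (t : 'rV[K]_(a * b * c)) (y : nat -> nat -> K).

Definition tens (y : nat -> K) : 'rV[K]_(a * b * c) := \row_l tensor_entry y l.

Definition sum_tens s y := \sum_(p < s) tens (y p).

Lemma sum_tensE s y : sum_tens s y = \row_l sum_entry s y l.
Proof.
apply/rowP => l; rewrite mxE summxE; apply: eq_bigr => p _.
by rewrite mxE.
Qed.

Definition rank_le s : set 'rV[K]_(a * b * c) :=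
  [set t | exists y, t = sum_tens s y]%classic.

Definition rank_eq r : set 'rV[K]_(a * b * c) :=
  [set t | rank_le r t /\ forall s, (s < r)%N -> ~ rank_le s t]%classic.

(** One inclusion between the sets of summands suffices, because [y] and [y'] can be exchanged. *)
Definition unique_sum r t :=
  forall y y', t = sum_tens r y -> t = sum_tens r y' ->
  forall p, (p < r)%N -> exists2 p', (p' < r)%N & tens (y p) = tens (y' p').

Lemma tens0 : tens (fun=> 0) = 0.
Proof. by apply/rowP => l; rewrite !mxE /tensor_entry !mul0r. Qed.

Lemma tensE (y : nat -> K) :
  tens y = (\row_i y i) *t (\row_j y (a + j)%N) *t (\row_k y (a + b + k)%N).
Proof. by apply/rowP => l; rewrite !mxE. Qed.

Lemma tens_surj (u : 'rV[K]_a) (v : 'rV[K]_b) (w : 'rV[K]_c) :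
  exists z : nat -> K, tens z = u *t v *t w.
Proof.
pose get n (x : 'rV[K]_n) k := if insub k is Some i then x 0 i else 0.
have getE n (x : 'rV[K]_n) (i : 'I_n) : get n x i = x 0 i.
  by rewrite /get valK.
pose z i := if (i < a)%N then get _ u i
  else if (i < a + b)%N then get _ v (i - a)%N else get _ w (i - (a + b))%N.
have zu : \row_i z i = u.
  by apply/rowP => i; rewrite mxE /z ltn_ord getE.
have zv : \row_j z (a + j)%N = v.
  apply/rowP => j; rewrite mxE /z ltnNge leq_addr /= ltn_add2l ltn_ord.
  by rewrite addKn getE.
have zw : \row_k z (a + b + k)%N = w.
  apply/rowP => k; rewrite mxE /z -addnA ltnNge leq_addr /= addnA ltnNge.
  by rewrite leq_addr /= addKn getE.
by exists z; rewrite tensE zu zv zw.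
Qed.

Lemma rank_le_mono s s' : (s <= s')%N -> (rank_le s `<=` rank_le s')%classic.
Proof.
move=> le_ss' t [y ->]; exists (fun p => if (p < s)%N then y p else fun=> 0).
rewrite /sum_tens (big_ord_widen _ (fun p => tens (y p)) le_ss') big_mkcond /=.
by apply: eq_bigr => p _; case: ifP; rewrite ?tens0.
Qed.

Lemma rank_eqS r t : rank_eq r.+1 t <-> rank_le r.+1 t /\ ~ rank_le r t.
Proof.
split=> [[h1 h2]|[h1 h2]]; split => //; first exact: h2.
by move=> s sr hs; apply: h2; apply: rank_le_mono hs.
Qed.

Lemma rank_le_add s s' y y' :
  exists z, sum_tens (s + s') z = sum_tens s y + sum_tens s' y'.
Proof.
exists (fun p => if (p < s)%N then y p else y' (p - s)%N).
rewrite /sum_tens big_split_ord /=; congr (_ + _); apply: eq_bigr => p _.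
  by rewrite ltn_ord.
by rewrite ltnNge leq_addr /= addKn.
Qed.

End Field.
End SumsOfPureTensors.

Arguments sum_entry {a b c A} s y l.
Arguments tens {a b c K} y.
Arguments sum_tens {a b c K} s y.
Arguments rank_le : clear implicits.
Arguments rank_eq : clear implicits.
Arguments unique_sum : clear implicits.

(** * Rank and uniqueness of decompositions in terms of parameters *)

Section Decompositions.
Variables (K : fieldType) (U V W : vectType K).
Local Notation a := (\dim {:U}).
Local Notation b := (\dim {:V}).
Local Notation c := (\dim {:W}).
Implicit Types (t : tensor U V W) (d : seq (tensor U V W)).

Lemma coords_surj (E : vectType K) (x : 'rV[K]_(\dim {:E})) :
  exists u : E, coords u = x.
Proof.
exists (\sum_i x 0 i *: (vbasis {:E})`_i); apply/rowP => i.
by rewrite mxE coord_sum_free // (basis_free (vbasisP _)).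
Qed.

Lemma pure_tensorP t :
  (exists u v w, t = pure_tensor u v w) <-> exists y, t = tens y.
Proof.
split=> [[u [v [w ->]]]|[y ->]].
  have [y yE] := tens_surj (coords u) (coords v) (coords w).
  by exists y; rewrite yE.
rewrite tensE; have [u <-] := coords_surj (E := U) (\row_i y i).
have [v <-] := coords_surj (E := V) (\row_j y (a + j)%N).
by have [w <-] := coords_surj (E := W) (\row_k y (a + b + k)%N); exists u, v, w.
Qed.

Lemma decomposition_mkseq t d : decomposition t d ->
  exists2 y, d = mkseq (fun p => tens (y p)) (size d) & t = sum_tens (size d) y.
Proof.
move=> [hd tE].
have /choice[y hy] p : exists y, (p < size d)%N -> nth 0 d p = tens y.
  have [pd|] := ltnP p (size d); last by exists (fun=> 0).
  by have [_ /pure_tensorP[y ->]] := hd _ (mem_nth 0 pd); exists y.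
exists y.
  apply: (@eq_from_nth _ 0) => [|p pd]; first by rewrite size_mkseq.
  by rewrite nth_mkseq // hy.
rewrite tE (big_nth 0) big_mkord; apply: eq_bigr => p _.
by rewrite hy.
Qed.

Lemma nonzero_decomposition s y :
  decomposition (sum_tens s y : tensor U V W)
    [seq x <- mkseq (fun p => tens (y p)) s | x != 0].
Proof.
split=> [x|].
  rewrite mem_filter => /andP[x0 /mapP[p _ xE]]; split=> //.
  by apply/pure_tensorP; exists (y p).
rewrite big_filter [RHS]big_mkcond /= big_map -[s in iota _ s]subn0 big_mkord.
by apply: eq_bigr => p _; case: eqP.
Qed.

Lemma rank_le_decomposition s t : rank_le a b c K s t ->
  exists2 d, decomposition t d & (size d <= s)%N.
Proof.
move=> [y ->]; exists [seq x <- mkseq (fun p => tens (y p)) s | x != 0].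
  exact: nonzero_decomposition.
by rewrite size_filter (leq_trans (count_size _ _)) // size_mkseq.
Qed.

Lemma has_rankE r : has_rank U V W r = rank_eq a b c K r.
Proof.
apply/funext => t; apply/propext; split=> [[[d dt sd] hr]|[ht hr]].
  split; first by have [y _ ->] := decomposition_mkseq dt; rewrite sd; exists y.
  move=> s sr /rank_le_decomposition[d' /hr rd' d's].
  by have := leq_trans rd' d's; rewrite leqNgt sr.
have hr' d : decomposition t d -> (r <= size d)%N.
  move=> /decomposition_mkseq[y _ tE]; rewrite leqNgt; apply/negP => /hr.
  by apply; exists y.
split=> //; have [d dt sd] := rank_le_decomposition ht.
by exists d => //; apply/eqP; rewrite eqn_leq sd hr'.
Qed.

(** No summand is zero, since dropping it would give a decomposition shorter than the rank. *)
Lemma rank_eq_decomposition r t y : has_rank U V W r t -> t = sum_tens r y ->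
  decomposition t (mkseq (fun p => tens (y p)) r).
Proof.
move=> [_ hr] tE; have := nonzero_decomposition r y; rewrite -tE => dt.
suff h0 : all (fun x : tensor U V W => x != 0) (mkseq (fun p => tens (y p)) r).
  by rewrite -[mkseq _ _](all_filterP h0).
rewrite all_count eqn_leq count_size size_mkseq -size_filter.
exact: hr.
Qed.

Lemma unique_decompositionE r t : has_rank U V W r t ->
  (unique_decomposition U V W r t <-> unique_sum a b c K r t).
Proof.
move=> ht; split=> [[d [dt sd hd]] y y' ty ty' p pr|hu].
  have dy := hd _ (rank_eq_decomposition ht ty) (size_mkseq _ _).
  have dy' := hd _ (rank_eq_decomposition ht ty') (size_mkseq _ _).
  have : (tens (y p) : tensor U V W) \in mkseq (fun p => tens (y' p)) r.
    by rewrite dy' -dy; apply: (map_f (fun p => tens (y p))); rewrite mem_iota.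
  by move=> /mapP[p' + ->]; rewrite mem_iota add0n => p'r; exists p'.
have [[d dt sd] _] := ht; have [y dE tE] := decomposition_mkseq dt.
rewrite sd in dE tE; exists d; split=> // d' d't sd'.
have [y' d'E t'E] := decomposition_mkseq d't; rewrite sd' in d'E t'E.
have sub z z' : t = sum_tens r z -> t = sum_tens r z' ->
    {subset (mkseq (fun p => tens (z p)) r : seq (tensor U V W)) <=
      mkseq (fun p => tens (z' p)) r}.
  move=> hz hz' x /mapP[p + ->]; rewrite mem_iota add0n => pr.
  have [p' p'r ->] := hu z z' hz hz' p pr.
  by apply: (map_f (fun p => tens (z' p))); rewrite mem_iota.
by move=> x; rewrite dE d'E; apply/idP/idP; apply: sub.
Qed.

End Decompositions.

(** * Ideals of the sets of sums of pure tensors *)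

Lemma rmorph_mmap n (A B T : comNzRingType) (h : {rmorphism B -> T})
    (g : {rmorphism A -> B}) (v : 'I_n -> B) (f : {mpoly A[n]}) :
  h (mmap g v f) = mmap (h \o g) (h \o v) f.
Proof.
rewrite /mmap rmorph_sum; apply: eq_bigr => m _; rewrite rmorphM rmorph_prod.
by congr (_ * _); apply: eq_bigr => i _; rewrite rmorphXn.
Qed.

Lemma meval_map_mpoly n (A B : comNzRingType) (g : {rmorphism A -> B})
    (v : 'I_n -> B) (f : {mpoly A[n]}) : (map_mpoly g f).@[v] = mmap g v f.
Proof.
rewrite /map_mpoly (rmorph_mmap (meval v)) /mmap; apply: eq_bigr => m _.
rewrite /= mevalC; congr (_ * _); apply: eq_bigr => i _.
by rewrite /= mevalXU.
Qed.

Lemma horner_mmap n (A : comNzRingType) (v : 'I_n -> {poly A})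
    (f : {mpoly A[n]}) x :
  (mmap polyC v f).[x] = f.@[fun i => (v i).[x]].
Proof.
rewrite -[LHS]/(horner_eval x _) rmorph_mmap /meval /mmap.
by apply: eq_bigr => m _; rewrite /= /horner_eval hornerC.
Qed.

Lemma poly_vanishing_eq0 (K : numDomainType) (p : {poly K}) :
  (forall k : nat, p.[k%:R] = 0) -> p = 0.
Proof.
move=> p0; apply/eqP/negPn/negP => pn0.
have := @max_poly_roots _ p [seq k%:R | k <- iota 0 (size p)] pn0.
rewrite size_map size_iota ltnn => h; suff: false by []; apply: h.
  by apply/allP => _ /mapP[k _ ->]; apply/rootP.
rewrite map_inj_uniq ?iota_uniq // => i j /eqP.
by rewrite eqr_nat => /eqP.
Qed.

Section RealPoints.
Variables (R : rcfType) (N : nat).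
Implicit Types (S : set 'rV[R]_N) (x : 'rV[R]_N) (p : {mpoly R[N]}).

Definition complex_point x : 'rV[R[i]]_N := map_mx (real_complex R) x.

Lemma peval_toC p x : peval (toC p) (complex_point x) = (peval p x)%:C%C.
Proof.
rewrite toCE /peval meval_map_mpoly -[RHS]/(real_complex R _).
rewrite [in RHS]/meval [RHS]rmorph_mmap /mmap; apply: eq_bigr => m _.
by congr (_ * _); apply: eq_bigr => i _; rewrite /= mxE.
Qed.

Lemma vanishing_re_im S f : vanishing (complex_point @` S)%classic f <->
  vanishing S (re_mpoly f) /\ vanishing S (im_mpoly f).
Proof.
have fE x : peval f (complex_point x) =
    (peval (re_mpoly f) x +i* peval (im_mpoly f) x)%C.
  rewrite {1}[f]mpoly_complexE /peval mevalD mevalM mevalC -!/(peval _ _).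
  by rewrite !peval_toC [RHS]complexE.
split=> [f0|[r0 i0] _ [x Sx <-]]; last by rewrite fE r0 // i0.
by split=> x Sx; have := f0 _ (ex_intro2 _ _ x Sx erefl); rewrite fE => -[].
Qed.

End RealPoints.

Section RankLocus.
Variables a b c : nat.

Lemma peval_sum_tens (K : fieldType) s (y : nat -> nat -> K)
    (f : {mpoly K[a * b * c]}) :
  peval f (sum_tens s y) = f.@[sum_entry s y].
Proof. by apply: meval_eq => l; rewrite sum_tensE mxE. Qed.

Lemma peval_curve (K : fieldType) s (L : nat -> nat -> {poly K}) x
    (f : {mpoly K[a * b * c]}) :
  peval f (sum_tens s (fun p i => (L p i).[x])) =
  (mmap polyC (sum_entry s L) f).[x].
Proof.
rewrite horner_mmap peval_sum_tens; apply: meval_eq => l.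
by rewrite -/(horner_eval x _) rmorph_sum_entry.
Qed.

(* Two parameter points are joined by a line, along which f and g restrict to *)
(* univariate polynomials.                                                    *)
Lemma rank_le_irreducible (K : numFieldType) s (f g : {mpoly K[a * b * c]}) :
  (forall t, rank_le a b c K s t -> peval f t * peval g t = 0) ->
  vanishing (rank_le a b c K s) f \/ vanishing (rank_le a b c K s) g.
Proof.
move=> fg0.
have [?|nf] := pselect (vanishing (rank_le a b c K s) f); first by left.
right=> _ [y1 ->]; apply/eqP/negPn/negP => g1; apply: nf => _ [y0 ->].
apply/eqP/negPn/negP => f0.
pose L p i := (y0 p i)%:P + (y1 p i - y0 p i) *: 'X.
pose F := mmap polyC (sum_entry s L) f; pose G := mmap polyC (sum_entry s L) g.
have L0 p i : (L p i).[0] = y0 p i.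
  by rewrite hornerD hornerZ hornerC hornerX mulr0 addr0.
have L1 p i : (L p i).[1] = y1 p i.
  by rewrite hornerD hornerZ hornerC hornerX mulr1 subrKC.
have Fn0 : F != 0.
  apply: contraNneq f0 => F0; have := peval_curve s L 0 f.
  rewrite -/F F0 horner0 => <-; apply/eqP; congr peval; congr sum_tens.
  by apply/funext => p; apply/funext => i; rewrite L0.
have Gn0 : G != 0.
  apply: contraNneq g1 => G0; have := peval_curve s L 1 g.
  rewrite -/G G0 horner0 => <-; apply/eqP; congr peval; congr sum_tens.
  by apply/funext => p; apply/funext => i; rewrite L1.
suff /eqP : F * G = 0 by rewrite mulf_eq0 (negbTE Fn0) (negbTE Gn0).
apply: poly_vanishing_eq0 => k; rewrite hornerM -!peval_curve fg0 //.
by exists (fun p i => (L p i).[k%:R]).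
Qed.

Lemma vanishing_rank_le_prime (K : numFieldType) s :
  prime_ideal [pred f | `[< vanishing (rank_le a b c K s) f >]].
Proof.
split; first split; rewrite ?inE.
- by move=> t _; rewrite /peval meval0.
- apply/negP => /asboolW /(_ (sum_tens s (fun _ _ => 0)) (ex_intro _ _ erefl)).
  by rewrite /peval meval1 => /eqP; rewrite oner_eq0.
- move=> h f g; rewrite !inE => f0 g0 t st.
  by rewrite /peval mevalD mevalM -!/(peval _ t) f0 // g0 // mulr0 addr0.
- move=> f g; rewrite !inE => fg0.
  suff [h|h] : vanishing (rank_le a b c K s) f \/
      vanishing (rank_le a b c K s) g.
  + by rewrite (asboolT h).
  + by rewrite (asboolT h) orbT.
  by apply: rank_le_irreducible => t st; rewrite -mevalM -/(peval _ t) fg0.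
Qed.

Lemma complex_point_sum_tens (R : rcfType) s (y : nat -> nat -> R) :
  complex_point (sum_tens s y) =
  sum_tens s (fun p i => (y p i)%:C%C) :> 'rV_(a * b * c).
Proof.
apply/rowP => l; rewrite !sum_tensE !mxE -[LHS]/(real_complex R _).
exact: rmorph_sum_entry.
Qed.

(* On y1 + 'i * y2 the polynomial p takes the value at 'i of the restriction  *)
(* of p to the real line y1 + t * y2, which vanishes.                         *)
Lemma vanishing_rank_le_toC (R : rcfType) s (p : {mpoly R[a * b * c]}) :
  vanishing (rank_le a b c R s) p -> vanishing (rank_le a b c R[i] s) (toC p).
Proof.
move=> p0 _ [y ->].
pose L q i := (complex.Re (y q i))%:P + complex.Im (y q i) *: 'X.
pose h : {rmorphism {poly R} -> R[i]} :=
  horner_morph (fun x : R => mulrC 'i%C (real_complex R x)).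
have hC x : h x%:P = (x%:C)%C by apply: horner_morphC.
have hL q i : h (L q i) = y q i.
  rewrite /L -mul_polyC rmorphD rmorphM !hC /h /= horner_morphX.
  by rewrite [RHS]complexE mulrC.
have : mmap polyC (sum_entry s L) p = 0.
  apply: poly_vanishing_eq0 => k; rewrite -peval_curve p0 //.
  by exists (fun q i => (L q i).[k%:R]).
move=> /(congr1 h); rewrite rmorph_mmap rmorph0 => <-.
rewrite peval_sum_tens toCE meval_map_mpoly /mmap; apply: eq_bigr => m _.
congr (_ * _).
  by rewrite /= hC.
apply: eq_bigr => l _; rewrite /= rmorph_sum_entry.
congr (_ ^+ _); congr sum_entry; apply/funext => q; apply/funext => i.
by rewrite hL.
Qed.

(** Induction on k. With the last k summands fixed, of sum w, the translate of g by w vanishes on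
    X_r by induction, hence on X_(r+1) by hypothesis. *)
Lemma vanishing_rank_le_add (K : numFieldType) r (g : {mpoly K[a * b * c]}) k :
  (forall f : {mpoly K[a * b * c]}, vanishing (rank_le a b c K r) f ->
    vanishing (rank_le a b c K r.+1) f) ->
  vanishing (rank_le a b c K r) g -> vanishing (rank_le a b c K (r + k)) g.
Proof.
move=> hr g0; elim: k => [|k IH]; first by rewrite addn0.
move=> _ [y ->].
pose w : 'rV[K]_(a * b * c) := sum_tens k (fun p => y (r.+1 + p)%N).
pose gw := g \mPo [tuple 'X_i + (w 0 i)%:MP | i < a * b * c].
have gwE t : peval gw t = peval g (t + w).
  rewrite /peval comp_mpoly_meval; apply: meval_eq => i.
  by rewrite tnth_mktuple mevalD mevalXU mevalC mxE.
have -> : sum_tens (r + k.+1) y = sum_tens r.+1 y + w.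
  rewrite -addSnnS /sum_tens big_split_ord /=; congr (_ + _).
rewrite -gwE; apply: (hr gw) => [_ [z ->]|]; last by exists y.
rewrite gwE; apply: IH.
have [z' z'E] := @rank_le_add a b c K r k z (fun p => y (r.+1 + p)%N).
by exists z'.
Qed.

(** Some equation f of the complement of [O] is nonzero at a point x of [O]. It vanishes on X_r,
    which misses [O]. If X_r and X_(r+1) had the same ideal, f would vanish on X_rg, which contains
    x. *)
Lemma rank_le_not_dense (K : numFieldType) r rg (O : set 'rV[K]_(a * b * c)) :
  zariski_open O -> (O !=set0)%classic -> (O `<=` rank_eq a b c K rg)%classic ->
  (r < rg)%N ->
  exists2 g : {mpoly K[a * b * c]}, vanishing (rank_le a b c K r) g &
    ~ vanishing (rank_le a b c K r.+1) g.
Proof.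
move=> [I OI] [x Ox] Org r_rg; apply: contrapT => hn.
have hr f : vanishing (rank_le a b c K r) f ->
    vanishing (rank_le a b c K r.+1) f.
  by move=> f0; apply: contrapT => f1; apply: hn; exists f.
have [f If fx] : exists2 f, I f & peval f x <> 0.
  apply: contrapT => hf; have : (~` O)%classic x; last by apply.
  rewrite OI => f If; apply: contrapT => fx; by apply: hf; exists f.
have f0 : vanishing (rank_le a b c K r) f.
  move=> t rt; have : (~` O)%classic t by move=> /Org[_ /(_ r r_rg)]; apply.
  by rewrite OI => /(_ f If).
apply: fx; apply: (@vanishing_rank_le_add K r f (rg - r)) => //.
by rewrite subnKC 1?ltnW //; have [] := Org _ Ox.
Qed.

(** First g is replaced by a real h: otherwise its real and imaginary parts would vanish on the real
    X_(r+1), hence on the complex one, and so would g. Then p * h vanishes on the real X_(r+1),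
    whose ideal is prime and does not contain h. *)
Lemma vanishing_rank_eq (R : rcfType) r (g : {mpoly R[i][a * b * c]}) :
  vanishing (rank_le a b c R[i] r) g ->
  ~ vanishing (rank_le a b c R[i] r.+1) g ->
  forall p, vanishing (rank_eq a b c R r.+1) p ->
    vanishing (rank_le a b c R r.+1) p.
Proof.
move=> g0 g1 p p0.
have [h h0 h1] : exists2 h : {mpoly R[a * b * c]},
    vanishing (rank_le a b c R r) h & ~ vanishing (rank_le a b c R r.+1) h.
  have /vanishing_re_im[re0 im0] :
      vanishing (@complex_point R _ @` rank_le a b c R r)%classic g.
    move=> _ [_ [y ->] <-]; rewrite complex_point_sum_tens.
    by apply: g0; eexists.
  apply: contrapT => hn.
  have h1 h : vanishing (rank_le a b c R r) h ->
      vanishing (rank_le a b c R r.+1) h.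
    by move=> h0; apply: contrapT => h1; apply: hn; exists h.
  apply: g1 => t rt; rewrite [g]mpoly_complexE /peval mevalD mevalM.
  rewrite -!/(peval _ t) (vanishing_rank_le_toC (h1 _ re0)) //.
  by rewrite (vanishing_rank_le_toC (h1 _ im0)) // mulr0 addr0.
have [t rt|//|//] := @rank_le_irreducible R r.+1 p h.
have [/h0 ->|nrt] := pselect (rank_le a b c R r t); first by rewrite mulr0.
by rewrite p0 ?mul0r //; apply/rank_eqS.
Qed.

End RankLocus.

(** * Semialgebraic sets *)

Section Semialgebraic.
Variables (R : rcfType) (N : nat).

Definition env (x : 'rV[R]_N) : seq R := [seq x 0 i | i <- enum 'I_N].

Lemma size_env x : size (env x) = N.
Proof. by rewrite size_map size_enum_ord. Qed.

Lemma nth_env x (i : 'I_N) : (env x)`_i = x 0 i.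
Proof. by rewrite (nth_map i) ?size_enum_ord // nth_ord_enum. Qed.

(** A variable out of range becomes 0, the default value read beyond the end of [env x]. Inverses
    get a dummy value, as [rterm] excludes them. *)
Fixpoint poly_of_term (t : GRing.term R) : {mpoly R[N]} :=
  match t with
  | GRing.Var i => if insub i is Some j then 'X_j else 0
  | GRing.Const k => k%:MP
  | GRing.NatConst n => n%:R
  | GRing.Add u v => poly_of_term u + poly_of_term v
  | GRing.Opp u => - poly_of_term u
  | GRing.NatMul u n => poly_of_term u *+ n
  | GRing.Mul u v => poly_of_term u * poly_of_term v
  | GRing.Exp u n => poly_of_term u ^+ n
  | GRing.Inv _ => 0
  end.

Lemma peval_poly_of_term t x :
  GRing.rterm t -> peval (poly_of_term t) x = GRing.eval (env x) t.
Proof.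
rewrite /peval; elim: t => //=.
- move=> i _; case: insubP => [j _ <-|]; first by rewrite mevalXU nth_env.
  by rewrite -leqNgt => Ni; rewrite nth_default ?size_env // meval0.
- by move=> k _; rewrite mevalC.
- by move=> n _; rewrite rmorph_nat.
- by move=> u IHu v IHv /andP[/IHu <- /IHv <-]; rewrite mevalD.
- by move=> u IHu /IHu <-; rewrite mevalN.
- by move=> u IHu n /IHu <-; rewrite mevalMn.
- by move=> u IHu v IHv /andP[/IHu <- /IHv <-]; rewrite mevalM.
- by move=> u IHu n /IHu <-; rewrite rmorphXn.
Qed.

Definition sat_clause e (fg : seq (GRing.term R) * seq (GRing.term R)) :=
  all (fun t => GRing.eval e t == 0) fg.1 &&
  all (fun t => 0 < GRing.eval e t) fg.2.

Lemma qf_eval_w_clauses e ws :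
  ord.qf_eval e (ord.odnf_to_oform (map (@ord.w_to_oclause R) ws)) =
  has (sat_clause e) ws.
Proof.
elim: ws => //= -[f g] ws ->; congr (_ || _); rewrite /sat_clause /= andbT.
by congr (_ && _); [elim: f => //= t f -> | elim: g => //= t g ->].
Qed.

(** Disequalities and weak inequalities are split into cases, which leaves the equations and strict
    inequalities allowed in [semialgebraic]. *)
Lemma qf_eval_dnf e D : ord.qf_eval e (ord.odnf_to_oform D) =
  has (sat_clause e) (flatten (map (@ord.oclause_to_w R) D)).
Proof.
elim: D => //= bc D; rewrite has_cat => <-; congr (_ || _).
rewrite -qf_eval_w_clauses.
have /(ord.qf_evalP e) h1 := ord.dnf_to_form_qf [:: bc].
have /(ord.qf_evalP e) h2 :=
  ord.dnf_to_form_qf (map (@ord.w_to_oclause R) (ord.oclause_to_w bc)).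
rewrite /= orbF in h1; apply/h1/h2.
  by move=> h; apply/ord.oclause_to_wP/ord.oclause_neq_leq_elimP.
by move=> h; apply/ord.oclause_neq_leq_elimP/ord.oclause_to_wP.
Qed.

Lemma w_clauses_rterm D : all (@ord.dnf_rterm R) D ->
  all (fun fg => all (@GRing.rterm R) fg.1 && all (@GRing.rterm R) fg.2)
    (flatten (map (@ord.oclause_to_w R) D)).
Proof.
elim: D => //= bc D IH /andP[/ord.dnf_rterm_subproof hbc /IH hD].
rewrite all_cat hD andbT; apply: sub_all hbc => fg /=.
by rewrite /ord.dnf_rterm /= andbT.
Qed.

(** Tarski's quantifier elimination over a real closed field, followed by a disjunctive normal
    form. *)
Lemma definable_semialgebraic (f : ord.formula R) :
  semialgebraic [set x | ord.holds (env x) f]%classic.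
Proof.
pose wf := @qe_rcf.wf_QE_wproj R.
pose qf := ord.quantifier_elim (fun i bc => qe_rcf.qfr_to_formula
  (@qe_rcf.wproj R i bc)) (ord.to_rform f).
have /andP[qf_qf qf_r] := ord.quantifier_elim_wf wf (ord.to_rform_rformula f).
pose ws := flatten (map (@ord.oclause_to_w R) (ord.qf_to_odnf qf false)).
exists [seq (map poly_of_term fg.1, map poly_of_term fg.2) | fg <- ws].
apply/funext => x; apply/propext; rewrite /= has_map.
apply: (iff_trans (rwP (qe_rcf.rcf_satP _ _))).
rewrite /qe_rcf.rcf_sat /ord.proj_sat -/qf -ord.qf_to_dnfP ?qf_qf //.
rewrite qf_eval_dnf -/ws; set s2 := has (preim _ _) ws.
suff <- : has (sat_clause (env x)) ws = s2 by split.
rewrite {}/s2; have := w_clauses_rterm (ord.qf_to_dnf_rterm false qf_r).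
rewrite -/qf -/ws; elim: ws => //= -[g h] s IH /andP[/andP[gr hr] /IH ->].
congr (_ || _); rewrite /sat_clause /= !all_map.
have evalE (r : seq (GRing.term R)) (P : pred R) : all (@GRing.rterm R) r ->
    all (fun t => P (GRing.eval (env x) t)) r =
    all (fun t => P (peval (poly_of_term t) x)) r.
  by elim: r => //= t r IHr /andP[tr /IHr ->]; rewrite peval_poly_of_term.
congr (_ && _); first exact: (evalE g (fun v => v == 0)).
exact: (evalE h (fun v => 0 < v)).
Qed.

End Semialgebraic.

(** * First-order formulas for rank and non-uniqueness *)

Section Formulas.
Variable R : rcfType.
Implicit Types (e z : seq R) (f : ord.formula R).

Lemma set_nth_size (T : Type) (x0 : T) s x :
  set_nth x0 s (size s) x = rcons s x.
Proof. by rewrite set_nthE ltnn subnn cats1. Qed.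

(** The bound variables have indices k, ..., k + n - 1, so over an environment of size k their
    values are appended at its end. *)
Definition exists_block k n f := foldr (@ord.Exists R) f (iota k n).

Lemma holds_exists_block e k n f : size e = k ->
  ord.holds e (exists_block k n f) <->
  exists2 z, size z = n & ord.holds (e ++ z) f.
Proof.
rewrite /exists_block; elim: n e k => [|n IH] e k ek.
  split=> [h|[z /size0nil -> ]]; last by rewrite cats0.
  by exists [::]; rewrite ?cats0.
split=> /= [[x]|[[//|x z] /= [zn] h]].
  rewrite -ek set_nth_size => /IH[|z zn h]; first by rewrite size_rcons ek.
  by exists (x :: z); rewrite /= ?zn // -cat_rcons.
exists x; rewrite -ek set_nth_size; apply/IH; first by rewrite size_rcons ek.
by exists z; rewrite // cat_rcons.
Qed.

Definition forall_in (I : eqType) (r : seq I) (F : I -> ord.formula R) :=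
  foldr (fun i f => ord.And (F i) f) (ord.Bool true) r.

Lemma holds_forall_in (I : eqType) (r : seq I) F e :
  ord.holds e (forall_in r F) <-> forall i, i \in r -> ord.holds e (F i).
Proof.
elim: r => //= j r ->; split=> [[hj hr] i|h].
  by rewrite inE => /orP[/eqP->|/hr].
by split=> [|i ir]; apply: h; rewrite inE ?eqxx ?ir ?orbT.
Qed.

Definition exists_in (I : eqType) (r : seq I) (F : I -> ord.formula R) :=
  foldr (fun i f => ord.Or (F i) f) (ord.Bool false) r.

Lemma holds_exists_in (I : eqType) (r : seq I) F e :
  ord.holds e (exists_in r F) <-> exists2 i, i \in r & ord.holds e (F i).
Proof.
elim: r => [|j r IH] /=; first by split=> [|[]].
rewrite IH; split=> [[h|[k kr h]]|[k]].
- by exists j; rewrite ?mem_head.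
- by exists k; rewrite // inE kr orbT.
- by rewrite inE => /orP[/eqP->|kr h]; [left|right; exists k].
Qed.

Variables a b c : nat.
Local Notation q := (a + b + c)%N.

Definition tensor_term (v : nat -> nat) (l : 'I_(a * b * c)) : GRing.term R :=
  let ij := mxtens_unindex (mxtens_unindex l).1 in
  GRing.Mul (GRing.Mul (GRing.Var _ (v ij.1)) (GRing.Var _ (v (a + ij.2)%N)))
    (GRing.Var _ (v (a + b + (mxtens_unindex l).2)%N)).

(* The i-th coordinate of the p-th parameter of a sum of pure tensors is the  *)
(* variable of index k + (p * q + i).                                         *)
Definition var k p i := (k + (p * q + i))%N.

Definition sum_term s k l : GRing.term R :=
  foldr (fun p t => GRing.Add (tensor_term (var k p) l) t) (GRing.NatConst _ 0)
    (iota 0 s).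

Definition params e k p i : R := e`_(var k p i).

Lemma eval_sum_term e s k l :
  GRing.eval e (sum_term s k l) = sum_entry s (params e k) l.
Proof.
rewrite /sum_term /sum_entry.
rewrite -(big_mkord xpredT (fun p => tensor_entry (params e k p) l)).
rewrite /index_iota subn0; elim: (iota 0 s) => /= [|p r ->].
  by rewrite big_nil.
by rewrite big_cons.
Qed.

Definition sum_formula s k :=
  forall_in (enum 'I_(a * b * c)) (fun l =>
    ord.Equal (GRing.Var _ (val l)) (sum_term s k l)).

Lemma holds_sum_formula (x : 'rV[R]_(a * b * c)) e s k :
  ord.holds (env x ++ e) (sum_formula s k) <->
  x = sum_tens s (params (env x ++ e) k).
Proof.
rewrite holds_forall_in sum_tensE; split=> [h|xE l _].
  apply/rowP => l; have := h l; rewrite mem_enum => /(_ isT).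
  by rewrite mxE /= eval_sum_term nth_cat size_env ltn_ord nth_env.
rewrite /= eval_sum_term nth_cat size_env ltn_ord nth_env.
by rewrite [in LHS]xE mxE.
Qed.

Definition disjoint_formula p r k k' :=
  forall_in (iota 0 r) (fun p' => ord.Not
    (forall_in (enum 'I_(a * b * c)) (fun l =>
      ord.Equal (tensor_term (var k p) l) (tensor_term (var k' p') l)))).

Lemma holds_disjoint_formula e p r k k' :
  ord.holds e (disjoint_formula p r k k') <->
  forall p', (p' < r)%N ->
    tens (params e k p) <> tens (params e k' p') :> 'rV_(a * b * c).
Proof.
rewrite holds_forall_in; split=> h p'.
  move=> p'r eq_t; have := h p'; rewrite mem_iota => /(_ p'r); apply.
  apply/holds_forall_in => l _ /=.
  by move/rowP: eq_t => /(_ l); rewrite !mxE.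
rewrite mem_iota => p'r /holds_forall_in eq_t; apply: (h p' p'r).
apply/rowP => l; rewrite !mxE; apply: eq_t.
by rewrite mem_enum.
Qed.

(** The flattening of [s] rows of [q] parameters that [params] reads back. *)
Definition block (s : nat) (y : nat -> nat -> R) :=
  mkseq (fun m => y (m %/ q)%N (m %% q)%N) (s * q).

Lemma size_block s y : size (block s y) = (s * q)%N.
Proof. exact: size_mkseq. Qed.

Lemma params_block e e' s y p i : (p < s)%N -> (i < q)%N ->
  params (e ++ block s y ++ e') (size e) p i = y p i.
Proof.
move=> ps iq; have psq : (p * q + i < s * q)%N.
  by apply: leq_trans (leq_mul ps (leqnn q)); rewrite mulSn addnC ltn_add2r.
rewrite /params /var nth_cat ltnNge leq_addr /= addKn nth_cat size_block psq.
have q0 : (0 < q)%N by apply: leq_ltn_trans iq.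
by rewrite nth_mkseq // divnMDl // divn_small // addn0 modnMDl modn_small.
Qed.

Lemma tens_params_block e e' s y p : (p < s)%N ->
  tens (params (e ++ block s y ++ e') (size e) p) = tens (y p)
    :> 'rV_(a * b * c).
Proof.
move=> ps; apply/rowP => l; rewrite !mxE /tensor_entry.
have ltq := ltn_ord (mxtens_unindex l).2.
have lta := ltn_ord (mxtens_unindex (mxtens_unindex l).1).1.
have ltb := ltn_ord (mxtens_unindex (mxtens_unindex l).1).2.
rewrite !params_block //; lia.
Qed.

Lemma sum_tens_params_block e e' s y :
  sum_tens s (params (e ++ block s y ++ e') (size e)) = sum_tens s y
    :> 'rV_(a * b * c).
Proof. by apply: eq_bigr => p _; apply: tens_params_block. Qed.

Definition rank_le_formula s :=
  exists_block (a * b * c) (s * q) (sum_formula s (a * b * c)).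

Lemma holds_rank_le_formula s x :
  ord.holds (env x) (rank_le_formula s) <-> rank_le a b c R s x.
Proof.
rewrite holds_exists_block ?size_env //.
split=> [[z _ /holds_sum_formula ->]|[y xE]]; first by eexists.
exists (block s y); rewrite ?size_block //; apply/holds_sum_formula.
have := sum_tens_params_block (env x) [::] s y.
by rewrite cats0 size_env => ->.
Qed.

Definition nonunique_formula r :=
  let N := (a * b * c)%N in
  exists_block N (r * q) (exists_block (N + r * q) (r * q)
    (ord.And (sum_formula r N) (ord.And (sum_formula r (N + r * q))
      (exists_in (iota 0 r) (fun p => disjoint_formula p r N (N + r * q)))))).

Lemma holds_nonunique_formula r x :
  ord.holds (env x) (nonunique_formula r) <-> ~ unique_sum a b c R r x.
Proof.
rewrite holds_exists_block ?size_env //; split.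
  move=> [z zr /holds_exists_block[|z' z'r]].
    by rewrite size_cat size_env zr.
  rewrite -catA => -[/holds_sum_formula xE [/holds_sum_formula x'E]].
  move=> /holds_exists_in[p]; rewrite mem_iota => pr /holds_disjoint_formula hp.
  by move=> /(_ _ _ xE x'E p pr)[p' /hp].
move=> nu; have [y [y' [p [xE x'E pr hp]]]] : exists y y' p,
    [/\ x = sum_tens r y, x = sum_tens r y', (p < r)%N
      & forall p', (p' < r)%N -> tens (y p) <> tens (y' p') :> 'rV_(a * b * c)].
  apply: contrapT => hn; apply: nu => y y' xE x'E p pr.
  apply: contrapT => hp; apply: hn; exists y, y', p; split=> // p' p'r eq_t.
  by apply: hp; exists p'.
exists (block r y); first exact: size_block.
apply/holds_exists_block; first by rewrite size_cat size_env size_block.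
exists (block r y'); first exact: size_block.
have Ny p0 : (p0 < r)%N ->
    tens (params ((env x ++ block r y) ++ block r y') (a * b * c) p0) =
      tens (y p0) :> 'rV_(a * b * c).
  by move=> /(tens_params_block (env x) (block r y') y); rewrite size_env catA.
have Ny' p0 : (p0 < r)%N ->
    tens (params ((env x ++ block r y) ++ block r y') (a * b * c + r * q) p0) =
      tens (y' p0) :> 'rV_(a * b * c).
  move=> /(tens_params_block (env x ++ block r y) [::] y').
  by rewrite size_cat size_env size_block cats0.
split; [|split].
- rewrite -catA; apply/holds_sum_formula; rewrite catA [LHS]xE.
  by apply: eq_bigr => p0 _; rewrite Ny.
- rewrite -catA; apply/holds_sum_formula; rewrite catA [LHS]x'E.
  by apply: eq_bigr => p0 _; rewrite Ny'.
apply/holds_exists_in; exists p; first by rewrite mem_iota.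
by apply/holds_disjoint_formula => p' p'r; rewrite Ny // Ny' //; apply: hp.
Qed.

Lemma semialgebraic_nonunique r : semialgebraic
  [set t | rank_eq a b c R r.+1 t /\ ~ unique_sum a b c R r.+1 t]%classic.
Proof.
have := @definable_semialgebraic R (a * b * c)%N
  (ord.And (ord.And (rank_le_formula r.+1) (ord.Not (rank_le_formula r)))
    (nonunique_formula r.+1)).
congr semialgebraic; apply/funext => x; apply/propext.
rewrite /= !holds_rank_le_formula holds_nonunique_formula.
by rewrite (rank_eqS r x).
Qed.

End Formulas.

(** * Comparison of dimensions *)

Lemma prime_chain_max (K : fieldType) N (S : set 'rV[K]_N) d :
  prime_chain S d ->
  exists2 D, prime_chain S D /\ (d <= D)%N & ~ prime_chain S D.+1.
Proof.
move=> Sd; apply: contrapT => hn.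
suff /prime_chain_bound : prime_chain S (d + N.+1) by lia.
elim: N.+1 => [|k IH]; first by rewrite addn0.
rewrite addnS; apply: contrapT => nS; apply: hn.
by exists (d + k)%N; rewrite // leq_addr.
Qed.

Section RealIdentifiability.
Variables (R : rcfType) (a b c r : nat).
Local Notation N := (a * b * c)%N.
Local Notation rankC := (rank_le a b c R[i]).

(** If the complex rank has not dropped, real decompositions are also complex ones of minimal
    length, and distinct real summands stay distinct over C. *)
Lemma nonunique_complex (Z : set 'rV[R[i]]_N) t :
  (forall x, rank_eq a b c R[i] r.+1 x ->
    ~ unique_sum a b c R[i] r.+1 x -> Z x) ->
  rank_eq a b c R r.+1 t -> ~ unique_sum a b c R r.+1 t ->
  Z (complex_point t) \/ rankC r (complex_point t).
Proof.
move=> hZ [[y tE] _] nu.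
have [?|nrt] := pselect (rankC r (complex_point t)); [by right|left].
apply: hZ.
  apply/rank_eqS; split=> //.
  by rewrite tE complex_point_sum_tens; eexists.
move=> hu; apply: nu => z z' zE z'E p pr.
have tC x : t = sum_tens r.+1 x ->
    complex_point t = sum_tens r.+1 (fun p i => (x p i)%:C%C).
  by move=> ->; rewrite complex_point_sum_tens.
have [p' p'r eq_t] := hu _ _ (tC z zE) (tC z' z'E) p pr.
exists p' => //; apply/rowP => l; move/rowP: eq_t => /(_ l); rewrite !mxE.
by rewrite /tensor_entry -!rmorphM => /complexI.
Qed.

Lemma no_long_chain (Z : set 'rV[R[i]]_N) (B : set 'rV[R]_N) D g :
  (forall t, B t -> Z (complex_point t) \/ rankC r (complex_point t)) ->
  ~ prime_chain Z D ->
  vanishing (rankC r) g -> ~ vanishing (rankC r.+1) g ->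
  ~ prime_chain (rankC r.+1) D.+1 -> ~ prime_chain B D.
Proof.
move=> hB nZ g0 g1 nr /prime_chain_extend[Q [hQ QB hchain]].
have hQ0 := hQ 0%N isT.
pose B1 := [set t | B t /\ Z (complex_point t)]%classic.
pose B2 := [set t | B t /\ rankC r (complex_point t)]%classic.
have QE S f : (forall p, vanishing S p -> toC p \in Q 0%N) ->
    vanishing (@complex_point R _ @` S)%classic f -> f \in Q 0%N.
  move=> hS /vanishing_re_im[/hS fr /hS fi].
  by rewrite [f]mpoly_complexE prime_idealD // prime_idealMl.
(* [B] is the union of [B1] and [B2], so a product of real polynomials vanishing on one and on the
   other lies in the prime [Q 0]. *)
have [Q1|Q2] : (forall p, vanishing B1 p -> toC p \in Q 0%N) \/
    (forall p, vanishing B2 p -> toC p \in Q 0%N).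
  have [?|nQ1] := pselect (forall p, vanishing B1 p -> toC p \in Q 0%N).
    by left.
  right=> p p0; apply/negPn/negP => nQp; apply: nQ1 => f f0.
  have : toC (f * p) \in Q 0%N.
    apply: QB => t Bt; rewrite /peval mevalM -!/(peval _ t).
    have [Zt|rt] := hB t Bt; first by rewrite f0 ?mul0r.
    by rewrite p0 ?mulr0.
  by rewrite rmorphM prime_idealM // (negbTE nQp) orbF.
- apply: nZ; exists Q; split=> // f f0; apply: QE Q1 _.
  by move=> _ [t [_ Zt] <-]; apply: f0.
have Qr f : vanishing (rankC r) f -> f \in Q 0%N.
  by move=> f0; apply: QE Q2 _ => _ [t [_ rt] <-]; apply: f0.
(* [Q 0] contains the ideal of X_r. Prepending the ideal of X_(r+1), which lacks g, lengthens the
   chain by one. *)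
apply: nr; pose P0 : {pred {mpoly R[i][N]}} :=
  [pred f | `[< vanishing (rankC r.+1) f >]].
exists (fun i => if i is j.+1 then Q j else P0); split.
- by case=> [|j] jD; [apply: vanishing_rank_le_prime | apply: hQ].
- by move=> f f0; rewrite inE.
case=> [|j] jD; last exact: hchain.
split=> [f|].
  rewrite inE => f0; apply: Qr => t rt.
  by apply: f0; apply: rank_le_mono rt.
by exists g; [apply: Qr | rewrite inE; apply/asboolPn].
Qed.

Lemma real_identifiable_of_complex rg (O : set 'rV[R[i]]_N) :
  zariski_open O -> (O !=set0)%classic ->
  (O `<=` rank_eq a b c R[i] rg)%classic -> (r.+1 < rg)%N ->
  zariski_general (rank_eq a b c R[i] r.+1) (unique_sum a b c R[i] r.+1) ->
  semialgebraic_general (rank_eq a b c R r.+1) (unique_sum a b c R r.+1).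
Proof.
move=> Oopen O0 Org r_rg [Z [_ hZ [d [Td nZd]]]].
have [g g0 g1] := rank_le_not_dense Oopen O0 Org (ltnW r_rg).
(* A polynomial vanishing on X_(r+1) vanishes on the Zariski closure of the tensors of rank r + 1,
   so the given chain also serves for X_(r+1). *)
have Rd : prime_chain (rankC r.+1) d.
  move: Td => [P [hP PS hchain]]; exists P; split=> // f f0; apply: PS => x.
  by apply; move=> t [rt _]; apply: f0.
(* The witness d may be smaller than the dimension of X_(r+1), whereas [no_long_chain] needs that
   X_(r+1) has no chain of length D + 1. *)
have [D [RD dD] nRD] := prime_chain_max Rd.
exists [set t | rank_eq a b c R r.+1 t /\ ~ unique_sum a b c R r.+1 t]%classic.
split=> //; first exact: semialgebraic_nonunique.
  by move=> t [].
exists D; split.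
  apply: prime_chain_contract RD => p p0.
  exact/vanishing_rank_le_toC/(vanishing_rank_eq g0 g1).
apply: (no_long_chain _ _ g0 g1 nRD) => [t [rt nu]|].
  exact: nonunique_complex hZ rt nu.
by move=> ZD; apply: nZd; apply: prime_chain_le ZD.
Qed.

End RealIdentifiability.

(** * Passage from complexified spaces to coordinates *)

Lemma dim_complexification (R : rcfType) (U : vectType R) :
  \dim {: complexification U} = \dim {:U}.
Proof. by rewrite dimvf. Qed.

Lemma zariski_general_ext (K : fieldType) N (S : set 'rV[K]_N) Q Q' :
  (forall x, S x -> Q x <-> Q' x) ->
  zariski_general S Q -> zariski_general S Q'.
Proof.
move=> QQ' [Z [Zc hZ dimZ]]; exists Z; split=> // x Sx nQ'.
by apply: hZ => //; rewrite QQ'.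
Qed.

Lemma semialgebraic_general_ext (R : realFieldType) N (S : set 'rV[R]_N) Q Q' :
  (forall x, S x -> Q x <-> Q' x) ->
  semialgebraic_general S Q -> semialgebraic_general S Q'.
Proof.
move=> QQ' [C [Cs CS hC dimC]]; exists C; split=> // x Sx nQ'.
by apply: hC => //; rewrite QQ'.
Qed.

Theorem theorem5p12 (R : realType) (U V W : vectType R) (r rg : nat) :
  (0 < r)%N ->
  generic_rank (complexification U) (complexification V) (complexification W)
    rg ->
  (r < rg)%N ->
  complex_identifiable (complexification U) (complexification V)
    (complexification W) r ->
  real_identifiable U V W r.
Proof.
case: r => // r _ [O [Oopen O0 Org]] r_rg /(zariski_general_ext
  (fun t => @unique_decompositionE _ _ _ _ _ t)) hC.
apply: (semialgebraic_general_ext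
  (fun t ht => iff_sym (@unique_decompositionE _ _ _ _ _ t ht))).
(* The type of [O] depends on the dimensions of the complexifications. Once these are rewritten as
   the real ones, both tensor spaces have coordinates of the same shape. *)
move: O Oopen O0 Org hC; rewrite !has_rankE /tensor !dim_complexification.
by move=> O *; apply: (real_identifiable_of_complex (O := O) (rg := rg)).
Qed.
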